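(* Fix a constant $r<\frac{1}{93}$ and let $n,k$ be positive integers with $k=rn$ and $k\ge 2$. Then $$\overline{\mathrm{dist}}_F(\mathcal{S}^{n,k},\mathcal{S}^n_+)>\frac{\sqrt{r-93r^2}}{\sqrt{162r+3}}.$$
   Context: $\mathcal{S}^n_+$ denotes the cone of $n\times n$ real symmetric positive semidefinite (PSD) matrices. For integers $2\le k\le n$, the $k$-PSD closure $\mathcal{S}^{n,k}$ is the set of all $n\times n$ real symmetric matrices all of whose $k\times k$ principal submatrices are PSD. For a matrix $M$, $\mathrm{dist}_F(M,\mathcal{S}^n_+)=\inf_{N\in\mathcal{S}^n_+}\|M-N\|_F$, where $\|\cdot\|_F$ is the Frobenius norm. For a set $\mathcal{K}$ of $n\times n$ matrices, $\overline{\mathrm{dist}}_F(\mathcal{K},\mathcal{S}^n_+)=\sup_{M\in\mathcal{K},\ \|M\|_F=1}\mathrm{dist}_F(M,\mathcal{S}^n_+)$. *)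

(* Defs.v *)
From mathcomp Require Import all_boot all_order all_algebra.
From mathcomp Require Import boolp classical_sets reals.
Set Implicit Arguments. Unset Strict Implicit. Unset Printing Implicit Defensive.
Import Order.TTheory GRing.Theory Num.Theory.
Local Open Scope ring_scope.
Local Open Scope classical_set_scope.

Section Defs.
Variable R : realType.

Definition symmetric_mx (n : nat) (M : 'M[R]_n) : Prop := M^T = M.

Definition psd (n : nat) (M : 'M[R]_n) : Prop :=
  symmetric_mx M /\ forall x : 'cV[R]_n, 0 <= (x^T *m M *m x) 0 0.

Definition kpsd_closure (n k : nat) : set 'M[R]_n :=
  [set M | symmetric_mx M /\
     forall f : 'I_k -> 'I_n, (forall i j : 'I_k, (i < j)%N -> (f i < f j)%N) ->
       psd (mxsub f f M)].

Definition frob (m n : nat) (M : 'M[R]_(m, n)) : R :=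
  Num.sqrt (\sum_(i < m) \sum_(j < n) M i j ^+ 2).

Definition distF_psd (n : nat) (M : 'M[R]_n) : R :=
  inf [set frob (M - N) | N in [set N : 'M[R]_n | psd N]].

Definition bardistF_psd (n : nat) (K : set 'M[R]_n) : R :=
  sup [set distF_psd M | M in [set M | K M /\ frob M = 1]].

End Defs.

(* Main.v *)
Require Import Defs.
From mathcomp Require Import all_boot all_order all_algebra.
From mathcomp Require Import archimedean zify ring lra.
From mathcomp Require Import boolp classical_sets reals.
From mathcomp Require Import topology normedtype sequences derive realfun exp.
Import Order.TTheory GRing.Theory Num.Theory.
Import numFieldNormedType.Exports.
Local Open Scope ring_scope.

(* Take an n x k matrix A of random signs and M = c I - A A^T with c = 5n/8.
   The k x k principal submatrices of M are PSD as soon as every k rows of A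
   form a matrix of squared operator norm at most c.  For k < n/93 this follows
   from a first-moment bound over all row sets of size k and all integer points
   z of the ball |z|^2 <= 25 k, because |A_S z|^2 is a sum of k independent
   squares with subgaussian moment generating function; rounding towards zero
   then passes from integer points to all vectors.
   Pairing M with A A^T in the Cauchy-Schwarz inequality gives
   dist(M) >= (F - c n k) / sqrt F, where F = |A A^T|_F^2 >= n^2 k, whereas
   |M|_F^2 = F - 2 c n k + c^2 n; these bounds suffice. *)

(** * Exponential moments of squared sign sums *)

Lemma le_of_is_derive_ge0 (R : realType) (f df : R -> R) (x : R) :
  (forall y, is_derive (y : R) (1 : R) f (df y)) -> (forall y, 0 <= y -> 0 <= df y) ->
  0 <= x -> f 0 <= f x.
Proof.
move=> fdf df0; rewrite le_eqVlt => /predU1P[<-//|x0].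
have cf : {within `[0, x], continuous f}%classic.
  apply: derivable_within_continuous => y _.
  by apply: ex_derive; exact: fdf.
have [c] := @MVT R f df 0 x x0 (fun y _ => fdf y) cf.
rewrite in_itv/= => /andP[c0 _] fE.
by rewrite -subr_ge0 fE subr0 mulr_ge0 ?df0 1?ltW.
Qed.

(** By evenness take x >= 0. Then 2 cosh y exp(-y^2/2) is nonincreasing for y >= 0: its derivative
    is nonpositive because sinh y <= y cosh y, which again follows by differentiating once. *)
Lemma cosh_le_gauss (R : realType) (x : R) :
  expR x + expR (- x) <= 2 * expR (x ^+ 2 / 2).
Proof.
wlog x0 : x / 0 <= x => [H|].
  by case: (lerP 0 x) => [/H//|/ltW]; rewrite -oppr_ge0 => /H; rewrite opprK sqrrN addrC.
have sinh_le (y : R) : 0 <= y -> 0 <= (y - 1) * expR y + (y + 1) * expR (- y).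
  move=> y0.
  pose f (y : R) := (y - 1) * expR y + (y + 1) * expR (- y).
  pose df (y : R) := y * expR y - y * expR (- y).
  have -> : 0 = f 0 by rewrite /f oppr0 expR0; ring.
  apply: (@le_of_is_derive_ge0 R f df) => // [z|z z0].
    apply: is_derive_eq; rewrite /df/= /GRing.scale/=; ring.
  rewrite /df -mulrBr mulr_ge0// subr_ge0 ler_expR; lra.
pose f (y : R) := - (expR (y - y ^+ 2 / 2) + expR (- y - y ^+ 2 / 2)).
pose df (y : R) := (y - 1) * expR (y - y ^+ 2 / 2) + (y + 1) * expR (- y - y ^+ 2 / 2).
have : f 0 <= f x.
  apply: (@le_of_is_derive_ge0 R f df) => // [z|z z0].
    by apply: is_derive_eq; rewrite /df/= /GRing.scale/=; field.
  by rewrite /df !expRD !mulrA -mulrDl mulr_ge0 ?expR_ge0 ?sinh_le.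
have -> : f 0 = - 2 by rewrite /f expr0n/= mul0r !oppr0 !addr0 expR0; ring.
by rewrite /f !expRD -mulrDl lerN2 (expRN (x ^+ 2 / 2)) ler_pdivrMr ?expR_gt0.
Qed.

Lemma sum_ffun_ordS (V : nmodType) (T : finType) (d : nat)
    (F : {ffun 'I_d.+1 -> T} -> V) :
  \sum_f F f =
  \sum_(b : T) \sum_(g : {ffun 'I_d -> T})
    F [ffun i => if unlift ord0 i is Some j then g j else b].
Proof.
rewrite pair_big /= (reindex (fun p : T * {ffun 'I_d -> T} =>
  [ffun i => if unlift ord0 i is Some j then p.2 j else p.1])) //=.
exists (fun f : {ffun 'I_d.+1 -> T} => (f ord0, [ffun j => f (lift ord0 j)])) => [[b g]|f] _ /=.
  by rewrite ffunE unlift_none; congr pair; apply/ffunP => j; rewrite !ffunE liftK.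
by apply/ffunP => i; rewrite ffunE; case: unliftP => [j|] ->//; rewrite ffunE.
Qed.

(* Integrating out one sign at a time: [cosh y <= exp (y^2 / 2)] replaces the
   coefficient [t] by at most [t / (1 - 2 t a^2)], and these steps compose. *)
Lemma rademacher_square_mgf (R : realType) (d : nat) (a : 'I_d -> R) (t x : R) :
  0 <= t -> 2 * t * (\sum_j a j ^+ 2) < 1 ->
  \sum_(f : {ffun 'I_d -> bool})
    expR (t * (x + \sum_j a j * (-1) ^+ f j) ^+ 2)
  <= 2 ^+ d * expR (t / (1 - 2 * t * \sum_j a j ^+ 2)
                     * (x ^+ 2 + \sum_j a j ^+ 2)).
Proof.
move=> t0; elim: d a x => [|d IH] a x.
  rewrite !big_ord0 => _; rewrite (eq_bigr (fun=> expR (t * x ^+ 2))) => [|f _].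
    by rewrite sumr_const card_ffun card_ord expn0 mulr1n expr0 mul1r addr0 mulr0 subr0 divr1.
  by rewrite big_ord0 addr0.
rewrite big_ord_recl/=; set s := \sum_(i < d) _; set a0 := a ord0 => ts.
have s0 : 0 <= s by apply: sumr_ge0 => i _; exact: sqr_ge0.
have a00 := sqr_ge0 a0; have x0 := sqr_ge0 x.
have ts' : 2 * t * s < 1 by nra.
pose u := t / (1 - 2 * t * s); pose v := t / (1 - 2 * t * (a0 ^+ 2 + s)).
have u0 : 0 <= u by rewrite divr_ge0//; lra.
have v0 : 0 <= v by rewrite divr_ge0//; lra.
(* For t > 0 this reads 1/u - 1/v = 2 a0^2: each sign lowers the reciprocal of the coefficient by
   twice its squared weight. *)
have uv : v = u + 2 * u * v * a0 ^+ 2.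
  by rewrite /u /v; field; apply/andP; split; apply: lt0r_neq0; lra.
have uv' : u <= v by have := mulr_ge0 (mulr_ge0 u0 v0) a00; lra.
rewrite sum_ffun_ordS.
(* The induction hypothesis at [x + a0] or [x - a0] depends on [b] only through the cross term of
   the square, so the sum over [b] is a cosh. *)
have step (b : bool) : \sum_(g : {ffun 'I_d -> bool})
    expR (t * (x + \sum_(j < d.+1) a j *
      (-1) ^+ [ffun i => if unlift ord0 i is Some j then g j else b] j) ^+ 2)
   <= 2 ^+ d * (expR (u * (x ^+ 2 + (a0 ^+ 2 + s))) * expR (2 * u * a0 * x * (-1) ^+ b)).
  have := IH (fun j => a (lift ord0 j)) (x + a0 * (-1) ^+ b) ts'.
  rewrite -/s -/u -expRD => H; apply: le_trans (le_trans H _).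
    apply: ler_sum => g _; rewrite big_ord_recl ffunE unlift_none addrA.
    by under eq_bigr => j _ do rewrite ffunE liftK.
  rewrite ler_pM2l ?exprn_gt0// ler_expR le_eqVlt; apply/orP; left; apply/eqP.
  by case: b {H}; rewrite ?expr0 ?expr1; ring.
apply: (@le_trans _ _ (2 ^+ d * (expR (u * (x ^+ 2 + (a0 ^+ 2 + s))) *
    (2 * expR ((2 * u * a0 * x) ^+ 2 / 2))))).
  rewrite big_bool/=; apply: le_trans (lerD (step true) (step false)) _.
  rewrite -!mulrDr ler_pM2l ?exprn_gt0// ler_pM2l ?expR_gt0//.
  by rewrite expr1 expr0 mulr1 mulrN1 addrC; exact: cosh_le_gauss.
rewrite [2 ^+ d.+1]exprSr -[leRHS]mulrA ler_pM2l ?exprn_gt0//.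
rewrite [leLHS]mulrCA ler_pM2l// -expRD ler_expR -/v.
have -> : (2 * u * a0 * x) ^+ 2 / 2 = 2 * u * u * a0 ^+ 2 * x ^+ 2 by field.
have -> : v * (x ^+ 2 + (a0 ^+ 2 + s)) = u * (x ^+ 2 + (a0 ^+ 2 + s))
   + 2 * u * v * a0 ^+ 2 * (x ^+ 2 + (a0 ^+ 2 + s)) by rewrite {1}uv; ring.
have c0 : 0 <= 2 * u * v * a0 ^+ 2 by have := mulr_ge0 (mulr_ge0 u0 v0) a00; lra.
rewrite lerD2l; apply: (@le_trans _ _ (2 * u * v * a0 ^+ 2 * x ^+ 2)).
  by rewrite 2?ler_wpM2r// ler_wpM2l// mulr_ge0.
by apply: ler_wpM2l => //; lra.
Qed.

(** The rows are independent: the exponential is a product over rows, so its sum over all sign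
    matrices is a product of row sums. A row in [S] is the one-row bound at x = 0; any other row
    contributes 2^d. *)
Lemma sign_rows_mgf (R : realType) (n d : nat) (S : {set 'I_n}) (a : 'I_d -> R) (t : R) :
  0 <= t -> 2 * t * (\sum_j a j ^+ 2) < 1 ->
  \sum_(A : {ffun 'I_n -> {ffun 'I_d -> bool}})
    expR (t * \sum_(i in S) (\sum_j a j * (-1) ^+ A i j) ^+ 2)
  <= #|{ffun 'I_n -> {ffun 'I_d -> bool}}|%:R
     * expR (t / (1 - 2 * t * \sum_j a j ^+ 2) * \sum_j a j ^+ 2) ^+ #|S|.
Proof.
move=> t0 ts; set E := expR _.
pose F i (g : {ffun 'I_d -> bool}) : R :=
  if i \in S then expR (t * (\sum_j a j * (-1) ^+ g j) ^+ 2) else 1.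
rewrite (eq_bigr (fun A : {ffun 'I_n -> {ffun 'I_d -> bool}} => \prod_i F i (A i)));
  last by move=> A _; rewrite mulr_sumr expR_sum big_mkcond.
rewrite -bigA_distr_bigA.
have -> : #|{ffun 'I_n -> {ffun 'I_d -> bool}}|%:R * E ^+ #|S|
    = \prod_(i < n) (2 ^+ d * (if i \in S then E else 1)).
  rewrite big_split/= prodr_const card_ord -big_mkcond prodr_const.
  by rewrite !card_ffun !card_ord card_bool !natrX.
apply: ler_prod => i _; rewrite /F; case: ifP => iS; apply/andP; split.
- by apply: sumr_ge0 => g _; exact: expR_ge0.
- have := @rademacher_square_mgf R d a t 0 t0 ts.
  rewrite expr0n/= add0r -/E => H; apply: le_trans H.
  by apply: ler_sum => g _; rewrite add0r.
- by apply: sumr_ge0.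
- by rewrite sumr_const card_ffun card_ord card_bool mulr1 natrX.
Qed.

(** * First-moment argument over row sets and net points *)

(** If every sign matrix had a bad pair [(S, x)], that pair alone would contribute more than exp(t
    L), so the total [W] over all matrices would be at least [N] exp(t L). Summing over matrices
    first bounds [W] by something smaller. Counting replaces probability throughout. *)
Lemma exists_signs_small_on_net (R : realType) (n d k : nat) (T : finType)
    (P : {set T}) (z : T -> 'I_d -> R) (t s L : R) :
  0 <= t -> 2 * t * s < 1 -> (forall x, x \in P -> \sum_j z x j ^+ 2 <= s) ->
  'C(n, k)%:R * #|P|%:R * expR (t / (1 - 2 * t * s) * s) ^+ k < expR (t * L) ->
  exists A : {ffun 'I_n -> {ffun 'I_d -> bool}},
    forall S : {set 'I_n}, #|S| = k -> forall x, x \in P ->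
      \sum_(i in S) (\sum_j z x j * (-1) ^+ A i j) ^+ 2 <= L.
Proof.
move=> t0 ts zP small; apply: contrapT => /forallNP H.
pose Om : finType := {ffun 'I_n -> {ffun 'I_d -> bool}}.
pose Q (A : Om) (S : {set 'I_n}) x : R :=
  \sum_(i in S) (\sum_j z x j * (-1) ^+ A i j) ^+ 2.
pose E := expR (t / (1 - 2 * t * s) * s).
have [N NE] : exists N : R, N = #|Om|%:R by exists #|Om|%:R.
have N0 : 0 < N by rewrite NE ltr0n !card_ffun card_bool !expn_gt0.
pose W := \sum_(A : Om) \sum_(S : {set 'I_n} | #|S| == k)
  \sum_(x in P) expR (t * Q A S x).
have lbW : N * expR (t * L) <= W.
  rewrite NE mulr_natl -sumr_const; apply: ler_sum => A _.
  have /existsNP[S /not_implyP[Sk /existsNP[x /not_implyP[xP /negP]]]] := H A.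
  rewrite -ltNge => QL.
  rewrite (bigD1 S) ?Sk//= (bigD1 x)//= -addrA ler_wpDr//.
    by rewrite addr_ge0 ?sumr_ge0// => *; rewrite ?expR_ge0 ?sumr_ge0// => *; exact: expR_ge0.
  by rewrite ler_expR ler_wpM2l// ltW.
have ubW : W <= N * ('C(n, k)%:R * #|P|%:R * E ^+ k).
  rewrite /W exchange_big/=.
  apply: (@le_trans _ _ (\sum_(S : {set 'I_n} | #|S| == k) \sum_(x in P) (N * E ^+ k))).
    apply: ler_sum => S /eqP Sk; rewrite exchange_big/=; apply: ler_sum => x xP.
    have xs := zP _ xP; have x0 : 0 <= \sum_j z x j ^+ 2 by apply: sumr_ge0 => j _; exact: sqr_ge0.
    have tx : 2 * t * \sum_j z x j ^+ 2 <= 2 * t * s by rewrite ler_wpM2l// mulr_ge0.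
    have := @sign_rows_mgf R n d S (z x) t t0 (le_lt_trans tx ts).
    rewrite Sk -NE => /le_trans; apply.
    rewrite ler_pM2l// lerXn2r ?nnegrE ?expR_ge0// ler_expR.
    apply: ler_pM => //; first by rewrite divr_ge0//; lra.
    by rewrite ler_wpM2l// lef_pV2 ?posrE; lra.
  rewrite !sumr_const -[X in _ *+ X]/#|[pred S : {set 'I_n} | #|S| == k]|.
  have -> : #|[pred S : {set 'I_n} | #|S| == k]| = 'C(n, k).
    by rewrite -[n in RHS]card_ord -card_draws cardsE.
  have alg (a b c e : R) : a * e * b * c = a * (c * b * e) by ring.
  by rewrite -(mulr_natr (N * _)) -(mulr_natr (N * _ * _)) alg lexx.
have := le_trans lbW ubW; rewrite ler_pM2l// => /le_lt_trans /(_ small).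
by rewrite ltxx.
Qed.

(** * Counting net points and row sets *)

(** An integer is coded as a sign and a magnitude (zero twice, harmless for an upper bound). Since
    10 a <= a^2 + 25, the ball lies in the l1 ball of radius 5d, where the weight (5/4)^(5d - |z|_1)
    is at least 1. The total weight factorises over coordinates, each giving at most (5/4)^5 times 2
    times the geometric sum 5. *)
Lemma card_l2_ball_le (R : realType) (d m : nat) :
  #|[set z : {ffun 'I_d -> bool * 'I_m} |
       (\sum_j (z j).2 ^ 2 <= 25 * d)%N]|%:R <= ((5 / 4) ^+ 5 * 10) ^+ d :> R.
Proof.
set P := [set _ | _].
have q0 : 0 <= 4 / 5 :> R by lra.
pose w (z : {ffun 'I_d -> bool * 'I_m}) : R :=
  (5 / 4) ^+ (5 * d) * \prod_j (4 / 5) ^+ (z j).2.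
have w0 z : 0 <= w z.
  by rewrite mulr_ge0 ?prodr_ge0// => *; rewrite exprn_ge0//; lra.
apply: (@le_trans _ _ (\sum_(z in P) w z)).
  rewrite -sum1_card natr_sum; apply: ler_sum => z; rewrite inE => zP.
  have le5 : (\sum_j (z j).2 <= 5 * d)%N.
    have : (\sum_j 10 * (z j).2 <= \sum_j ((z j).2 ^ 2 + 25))%N.
      apply: leq_sum => j _; apply: leq_trans (nat_Cauchy _ 5).
      by rewrite mulnCA mulnC.
    rewrite -big_distrr big_split/= sum_nat_const card_ord => H.
    have {H} := leq_trans H (leq_add zP (leqnn _)).
    by move: (\sum_j _)%N => a; lia.
  rewrite /w -expr_sum -(subnK le5) exprD -mulrA -exprMn.
  have -> : 5 / 4 * (4 / 5) = 1 :> R by field.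
  by rewrite expr1n mulr1 exprn_ege1//; lra.
rewrite -[leLHS]addr0; apply: (@le_trans _ _ (\sum_z w z)).
  by rewrite addr0 [leRHS](bigID (mem P))/= lerDl sumr_ge0.
rewrite -mulr_sumr [leRHS]exprMn -exprM ler_wpM2l ?exprn_ge0//; first by lra.
rewrite -(bigA_distr_bigA (fun (j : 'I_d) (p : bool * 'I_m) => (4 / 5) ^+ p.2 : R)).
rewrite prodr_const card_ord lerXn2r ?nnegrE//.
  by apply: sumr_ge0 => p _; exact: exprn_ge0.
rewrite -(pair_big xpredT xpredT (fun b (i : 'I_m) => (4 / 5) ^+ i : R))/=.
have geo : \sum_(i < m) (4 / 5 : R) ^+ i <= 5.
  have := subrX1 (4 / 5 : R) m; have := exprn_ge0 m q0; nra.
by rewrite big_bool/=; lra.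
Qed.

(** C(n,k) <= n^k / k!, and k^k <= k! e^k by induction from (1 + 1/m)^m <= e. *)
Lemma binomial_le_expR (R : realType) (n k : nat) : (0 < k)%N ->
  'C(n, k)%:R <= (expR 1 * (n%:R / k%:R)) ^+ k :> R.
Proof.
move=> k0; have kR : 0 < k%:R :> R by rewrite ltr0n.
have stirling (m : nat) : m%:R ^+ m <= m`!%:R * expR 1 ^+ m :> R.
  elim: m => [|m IH]; first by rewrite fact0 !expr0 mulr1.
  have [->|m0] := posnP m; first by
    rewrite factS fact0 !expr1 mul1r; have := expR_ge1Dx (1 : R); lra.
  have mR : 0 < m%:R :> R by rewrite ltr0n.
  have : (1 + m%:R^-1) ^+ m <= expR 1 :> R.
    have <- : expR (m%:R * m%:R^-1) = expR 1 :> R by rewrite mulfV ?lt0r_neq0.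
    rewrite expRM_natl.
    by rewrite lerXn2r ?nnegrE ?expR_ge0 ?expR_ge1Dx// addr_ge0// invr_ge0 ltW.
  have h1 : 0 <= 1 + m%:R^-1 :> R by rewrite addr_ge0// invr_ge0 ltW.
  move=> H; have := ler_pM (exprn_ge0 m (ltW mR)) (exprn_ge0 m h1) IH H.
  rewrite -exprMn mulrDr mulr1 mulfV ?lt0r_neq0// natr1.
  move=> /(ler_wpM2l (ler0n R m.+1)).
  by rewrite -exprS factS natrM [expR 1 ^+ m.+1]exprSr !mulrA.
have fact0 : 0 < k`!%:R :> R by rewrite ltr0n fact_gt0.
rewrite -(ler_pM2r fact0) -natrM bin_ffact.
apply: (@le_trans _ _ (n%:R ^+ k)).
  rewrite -natrX ler_nat.
  elim: (k) => [//|j IH]; rewrite ffactnSr expnSr.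
  by apply: leq_mul IH (leq_subr _ _).
rewrite exprMn expr_div_n.
have alg (a b c f : R) : a * (b * c) * f = b * (f * a * c) by ring.
rewrite alg ler_peMr ?exprn_ge0//.
by rewrite ler_pdivlMr ?exprn_gt0// mul1r stirling.
Qed.

(** After the binomial bound and a k-th root, it is enough that 10 (5/4)^5 e^(5/2) y < e^(3y/20) for
    y = n/k > 93. *)
Lemma union_bound_lt (R : realType) (n k : nat) : (0 < k)%N -> (93 * k < n)%N ->
  'C(n, k)%:R * ((5 / 4) ^+ 5 * 10) ^+ k * expR (3 / 2) ^+ k
  < expR (3 / 20 * n%:R) :> R.
Proof.
move=> k0 kn; have kR : 0 < k%:R :> R by rewrite ltr0n.
pose y : R := n%:R / k%:R.
have y93 : 93 < y by rewrite /y ltr_pdivlMr// -natrM ltr_nat.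
have -> : 3 / 20 * n%:R = k%:R * (3 / 20 * y) by rewrite /y; field; exact: lt0r_neq0.
rewrite (expRM_natl k).
apply: (@le_lt_trans _ _ ((expR 1 * y * ((5 / 4) ^+ 5 * 10) * expR (3 / 2)) ^+ k)).
  have D0 : 0 <= (5 / 4) ^+ 5 * 10 :> R by lra.
  move: (_ * 10) D0 => D D0; rewrite [leRHS]exprMn [X in _ <= X * _]exprMn.
  by rewrite !ler_wpM2r ?exprn_ge0 ?expR_ge0// binomial_le_expR.
have P0 : 0 <= expR 1 * y * ((5 / 4) ^+ 5 * 10) * expR (3 / 2).
  by apply: mulr_ge0 (expR_ge0 _); apply: mulr_ge0; [apply: mulr_ge0 (expR_ge0 _) _|]; lra.
rewrite ltrXn2r ?lt0n_neq0 ?nnegrE ?expR_ge0//.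
(* The tangent of exp at 0 trades the linear factor for an exponential. The remaining constant 93
   (5/4)^5 10 is about 2838, below (3/2)^20, which is about 3325 and at most e^10; the exponents
   then compare because y > 93. *)
have yE : y <= 93 * expR (y / 93 - 1).
  have := expR_ge1Dx (y / 93 - 1); lra.
have e1 : (3 / 2) ^+ 20 <= expR 10 :> R.
  have -> : 10 = 20 * (1 / 2) :> R by field.
  rewrite (expRM_natl 20) lerXn2r ?nnegrE ?expR_ge0//; first by lra.
  have := expR_ge1Dx (1 / 2 : R); lra.
have -> : expR 1 * y * ((5 / 4) ^+ 5 * 10) * expR (3 / 2)
   = y * ((5 / 4) ^+ 5 * 10) * expR (5 / 2).
  have -> : 5 / 2 = 1 + 3 / 2 :> R by field.
  rewrite expRD; ring.
apply: (@lt_le_trans _ _ (expR 10 * expR (5 / 2) * expR (y / 93 - 1))).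
  have := expR_gt0 (y / 93 - 1) => g0; have h0 := expR_gt0 (5 / 2 : R).
  rewrite [ltRHS]mulrAC ltr_pM2r//.
  have := ler_wpM2r (ltW g0) e1; lra.
rewrite -!expRD ler_expR; lra.
Qed.

(** * Quadratic forms: from integer points to all vectors *)

Lemma sum_mul_sqr_le (R : realFieldType) (I : finType) (a b : I -> R) :
  (\sum_i a i * b i) ^+ 2 <= (\sum_i a i ^+ 2) * (\sum_i b i ^+ 2).
Proof.
set P := \sum_i a i * b i; set B := \sum_i b i ^+ 2.
have B0 : 0 <= B by apply: sumr_ge0 => i _; exact: sqr_ge0.
have [/psumr_eq0P b0|Bn0] := eqVneq B 0.
  have -> : P = 0.
    apply: big1 => i _; suff -> : b i = 0 by rewrite mulr0.
    by apply/eqP; rewrite -sqrf_eq0 b0// => j _; exact: sqr_ge0.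
  by rewrite expr0n mulr_ge0// sumr_ge0// => i _; exact: sqr_ge0.
have Bp : 0 < B by rewrite lt0r Bn0.
have : 0 <= \sum_i (a i * B - b i * P) ^+ 2.
  by apply: sumr_ge0 => i _; exact: sqr_ge0.
have -> : \sum_i (a i * B - b i * P) ^+ 2
    = B * ((\sum_i a i ^+ 2) * B - P ^+ 2).
  transitivity (\sum_i (a i ^+ 2 * B ^+ 2 - a i * b i * (2 * B * P) + b i ^+ 2 * P ^+ 2)).
    by apply: eq_bigr => i _; ring.
  by rewrite big_split/= sumrB -!mulr_suml -/P -/B; ring.
by rewrite pmulr_rge0// subr_ge0.
Qed.

(** Rounding x towards zero stays in the ball and leaves a remainder with entries below 1 in
    absolute value, so 5 times the remainder is in the ball too. The supremum thus satisfies sup <=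
    (5/4) L + sup / 5. *)
Lemma le_of_integer_net (R : realType) (I : finType) (d : nat)
    (v : I -> 'I_d -> R) (L : R) :
  (forall (b : 'I_d -> bool) (m : 'I_d -> nat), (\sum_j m j ^ 2 <= 25 * d)%N ->
     \sum_i (\sum_j (-1) ^+ b j * (m j)%:R * v i j) ^+ 2 <= L) ->
  forall x : 'I_d -> R, \sum_j x j ^+ 2 <= 25 * d%:R ->
    \sum_i (\sum_j x j * v i j) ^+ 2 <= 25 / 16 * L.
Proof.
move=> net.
pose Q (x : 'I_d -> R) := \sum_i (\sum_j x j * v i j) ^+ 2.
pose E := [set Q x | x in [set x : 'I_d -> R | \sum_j x j ^+ 2 <= 25 * d%:R]]%classic.
(* A crude Cauchy-Schwarz bound suffices: finiteness is what makes [sup E] an upper bound and allows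
   [sup E / 5] to be absorbed. *)
have Eub : has_ubound E.
  exists (25 * d%:R * \sum_i \sum_j v i j ^+ 2) => _ [x /= xd <-].
  rewrite mulr_sumr; apply: ler_sum => i _.
  apply: le_trans (sum_mul_sqr_le _ _ x (v i)) _; apply: ler_wpM2r => //.
  by apply: sumr_ge0 => j _; exact: sqr_ge0.
have E0 : (E !=set0)%classic.
  exists (Q (fun=> 0)), (fun=> 0) => //=.
  by rewrite big1 ?mulr_ge0// => j _; rewrite expr0n.
have Qscale (c : R) x : Q (fun j => c * x j) = c ^+ 2 * Q x.
  rewrite /Q mulr_sumr; apply: eq_bigr => i _; rewrite -exprMn; congr (_ ^+ 2).
  by rewrite mulr_sumr; apply: eq_bigr => j _; rewrite mulrA.
(* [(a + b)^2 <= a^2 / (1 - e) + b^2 / e] with [e = 1/5], the mesh of the net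
   relative to the radius of the ball. *)
have Qadd x y : Q (fun j => x j + y j) <= 5 / 4 * Q x + 5 * Q y.
  rewrite /Q !mulr_sumr -big_split; apply: ler_sum => i _ /=.
  have -> : \sum_j (x j + y j) * v i j = (\sum_j x j * v i j) + \sum_j y j * v i j.
    by rewrite -big_split; apply: eq_bigr => j _; rewrite mulrDl.
  by have := sqr_ge0 ((\sum_j x j * v i j) / 2 - 2 * \sum_j y j * v i j); lra.
have step : sup E <= 5 / 4 * L + sup E / 5.
  apply: ge_sup => // _ [x /= xd <-].
  pose m j := Num.truncn `|x j|; pose b j := x j < 0.
  pose z j : R := (-1) ^+ b j * (m j)%:R.
  have mx j : (m j)%:R <= `|x j| < (m j)%:R + 1.
    by rewrite natr1; exact/truncn_itv.
  have xz j : `|x j - z j| = `|x j| - (m j)%:R.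
    rewrite -[x j in LHS]mulr_sign_norm /z -/(b j) -mulrBr normrM normr_sign mul1r.
    by rewrite ger0_norm// subr_ge0; case/andP: (mx j).
  have zd : (\sum_j m j ^ 2 <= 25 * d)%N.
    rewrite -(ler_nat R) natr_sum natrM; apply: le_trans xd; apply: ler_sum => j _.
    rewrite natrX -[leRHS]real_normK ?num_real// lerXn2r ?nnegrE//.
    by case/andP: (mx j).
  have ed : \sum_j (5 * (x j - z j)) ^+ 2 <= 25 * d%:R.
    rewrite -[d in leRHS]card_ord -sum1_card natr_sum mulr_sumr.
    apply: ler_sum => j _; rewrite -[leLHS]real_normK ?num_real// normrM xz.
    rewrite (ger0_norm (ler0n _ 5)); case/andP: (mx j) => l u.
    by have := ler0n R (m j); nra.
  have -> : x = (fun j => z j + (x j - z j)) by apply: funext => j; rewrite addrC subrK.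
  apply: le_trans (Qadd _ _) _; apply: lerD.
    by rewrite ler_wpM2l//; [lra | exact: net].
  have : Q (fun j => 5 * (x j - z j)) <= sup E.
    by apply: ub_le_sup => //; exists (fun j => 5 * (x j - z j)).
  rewrite Qscale; lra.
move=> x xd; have : Q x <= sup E by apply: ub_le_sup => //; exists x.
rewrite /Q; lra.
Qed.

(** By homogeneity, x is rescaled to squared norm 25 d, and (25/16) L / (25 d) = L / (16 d). *)
Lemma quad_le_of_integer_net (R : realType) (I : finType) (d : nat)
    (v : I -> 'I_d -> R) (L : R) : (0 < d)%N -> 0 <= L ->
  (forall (b : 'I_d -> bool) (m : 'I_d -> nat), (\sum_j m j ^ 2 <= 25 * d)%N ->
     \sum_i (\sum_j (-1) ^+ b j * (m j)%:R * v i j) ^+ 2 <= L) ->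
  forall x : 'I_d -> R,
    \sum_i (\sum_j x j * v i j) ^+ 2 <= L / (16 * d%:R) * \sum_j x j ^+ 2.
Proof.
move=> d0 L0 net x; have dR : 0 < d%:R :> R by rewrite ltr0n.
set s := \sum_j x j ^+ 2.
have s0 : 0 <= s by apply: sumr_ge0 => j _; exact: sqr_ge0.
have [s0'|sn0] := eqVneq s 0.
  have x0 j : x j = 0.
    apply/eqP; rewrite -sqrf_eq0.
    by move/psumr_eq0P : s0' => -> // i _; exact: sqr_ge0.
  rewrite big1 => [|i _]; first by rewrite s0' mulr0.
  by rewrite big1 ?expr0n// => j _; rewrite x0 mul0r.
have sp : 0 < s by rewrite lt0r sn0.
pose c := Num.sqrt (25 * d%:R / s).
have c2 : c ^+ 2 = 25 * d%:R / s by rewrite sqr_sqrtr// divr_ge0// mulr_ge0.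
have := @le_of_integer_net R I d v L net (fun j => c * x j).
have -> : \sum_j (c * x j) ^+ 2 = 25 * d%:R.
  under eq_bigr do rewrite exprMn.
  by rewrite -mulr_sumr -/s c2 mulfVK.
move=> /(_ (lexx _)).
have -> : \sum_i (\sum_j c * x j * v i j) ^+ 2 = c ^+ 2 * \sum_i (\sum_j x j * v i j) ^+ 2.
  rewrite mulr_sumr; apply: eq_bigr => i _; rewrite -exprMn; congr (_ ^+ 2).
  by rewrite mulr_sumr; apply: eq_bigr => j _; rewrite mulrA.
rewrite c2 mulrAC ler_pdivrMr// => H.
rewrite -(@ler_pM2l _ (25 * d%:R)) ?mulr_gt0//; apply: le_trans H _.
rewrite le_eqVlt; apply/orP; left; apply/eqP; field; exact: lt0r_neq0.
Qed.

(** A matrix and its transpose have the same operator norm: with w the image of y, |w|^4 = <y, v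
    w>^2 <= |y|^2 c |w|^2. The net bounds combinations of columns, whereas the PSD condition
    concerns combinations of rows. *)
Lemma quad_le_transpose (R : realType) (I J : finType) (v : I -> J -> R) (c : R) :
  0 <= c ->
  (forall x : J -> R, \sum_i (\sum_j x j * v i j) ^+ 2 <= c * \sum_j x j ^+ 2) ->
  forall y : I -> R, \sum_j (\sum_i y i * v i j) ^+ 2 <= c * \sum_i y i ^+ 2.
Proof.
move=> c0 H y; pose w j := \sum_i y i * v i j.
rewrite -[leLHS]/(\sum_j w j ^+ 2).
have w0 : 0 <= \sum_j w j ^+ 2 by apply: sumr_ge0 => j _; exact: sqr_ge0.
have y0 : 0 <= \sum_i y i ^+ 2 by apply: sumr_ge0 => j _; exact: sqr_ge0.
have wE : \sum_j w j ^+ 2 = \sum_i y i * (\sum_j w j * v i j).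
  under [RHS]eq_bigr do rewrite mulr_sumr.
  rewrite exchange_big; apply: eq_bigr => j _.
  by rewrite expr2 {2}/w mulr_sumr; apply: eq_bigr => i _; ring.
have := sum_mul_sqr_le _ _ y (fun i => \sum_j w j * v i j); rewrite -wE => H1.
have := le_trans H1 (ler_wpM2l y0 (H w)).
have [-> _|wn0] := eqVneq (\sum_j w j ^+ 2) 0; first by rewrite mulr_ge0.
have wp : 0 < \sum_j w j ^+ 2 by rewrite lt0r wn0.
by rewrite expr2 mulrA ler_pM2r// mulrC.
Qed.

(** * The sign matrix *)

Lemma exists_sign_matrix (R : realType) (n k : nat) : (0 < k)%N -> (93 * k < n)%N ->
  exists A : 'M[R]_(n, k), (forall i j, A i j ^+ 2 = 1) /\
    forall f : 'I_k -> 'I_n, injective f -> forall y : 'I_k -> R,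
      \sum_j (\sum_i y i * A (f i) j) ^+ 2 <= 5 / 8 * n%:R * \sum_i y i ^+ 2.
Proof.
move=> k0 kn; have kR : 0 < k%:R :> R by rewrite ltr0n.
(* An entry a of a net point satisfies a <= a^2 <= 25 k, so ['I_m] holds every magnitude. *)
pose m := (25 * k).+1.
pose P := [set z : {ffun 'I_k -> bool * 'I_m} | (\sum_j (z j).2 ^ 2 <= 25 * k)%N].
pose v (z : {ffun 'I_k -> bool * 'I_m}) (j : 'I_k) : R := (-1) ^+ (z j).1 * (z j).2%:R.
(* With L = 10 k n these give t s = 3/8, hence t s / (1 - 2 t s) = 3/2 and t L = 3n/20, the
   exponents of [union_bound_lt]; and L / (16 k) = 5n/8. *)
pose t : R := 3 / (200 * k%:R); pose s : R := 25 * k%:R.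
have t0 : 0 <= t by rewrite divr_ge0 ?mulr_ge0.
have ts : t * s = 3 / 8 by rewrite /t /s; field; exact: lt0r_neq0.
have vP z : z \in P -> \sum_j v z j ^+ 2 <= s.
  rewrite inE -(ler_nat R) natr_sum natrM; apply: le_trans.
  by apply: ler_sum => j _; rewrite exprMn sqrr_sign mul1r natrX.
have [||A HA] := @exists_signs_small_on_net R n k k _ P v t s (10 * k%:R * n%:R) t0 _ vP.
- by rewrite -mulrA ts; lra.
- have -> : t * (10 * k%:R * n%:R) = 3 / 20 * n%:R.
    by rewrite /t; field; exact: lt0r_neq0.
  have -> : t / (1 - 2 * t * s) * s = 3 / 2.
    by rewrite mulrAC ts -mulrA ts; field.
  apply: le_lt_trans (union_bound_lt R _ _ k0 kn).
  rewrite ler_wpM2r ?exprn_ge0 ?expR_ge0// ler_wpM2l//.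
  exact: card_l2_ball_le.
exists (\matrix_(i, j) (-1) ^+ A i j); split=> [i j|f finj].
  by rewrite mxE sqrr_sign.
apply: quad_le_transpose => [|x]; first by rewrite mulr_ge0//; lra.
under eq_bigr do under eq_bigr do rewrite mxE.
have -> : 5 / 8 * n%:R = 10 * k%:R * n%:R / (16 * k%:R) :> R.
  by field; exact: lt0r_neq0.
apply: (@quad_le_of_integer_net R 'I_k k (fun i j => (-1) ^+ A (f i) j)) => //.
  by rewrite !mulr_ge0.
move=> b c bc.
have cm j : (c j < m)%N.
  rewrite ltnS; apply: leq_trans bc; rewrite (bigD1 j)//=.
  by apply: leq_trans (leq_addr _ _); case: (c j) => // ?; rewrite leq_pmulr.
pose z := [ffun j => (b j, Ordinal (cm j))].
have zP : z \in P by rewrite inE; under eq_bigr do rewrite ffunE.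
have := HA (f @: 'I_k) _ z zP.
rewrite card_imset// card_ord => /(_ erefl).
rewrite big_imset/=; last by move=> ? ? _ _; exact: finj.
apply: le_trans; rewrite le_eqVlt; apply/orP; left; apply/eqP.
by apply: eq_bigr => i _; congr (_ ^+ 2); apply: eq_bigr => j _; rewrite /v ffunE.
Qed.

(** * Frobenius geometry and the PSD cone *)

Lemma quad_formE (R : realType) (n : nat) (M : 'M[R]_n) (x : 'cV[R]_n) :
  (x^T *m M *m x) 0 0 = \sum_i \sum_j M i j * (x i 0 * x j 0).
Proof.
rewrite mxE exchange_big; apply: eq_bigr => j _.
by rewrite mxE mulr_suml; apply: eq_bigr => i _; rewrite mxE; ring.
Qed.

Lemma sqr_frob (R : realType) (m n : nat) (M : 'M[R]_(m, n)) :
  frob M ^+ 2 = \sum_i \sum_j M i j ^+ 2.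
Proof.
by rewrite sqr_sqrtr// sumr_ge0// => i _; rewrite sumr_ge0// => j _; exact: sqr_ge0.
Qed.

Lemma frob_ge0 (R : realType) (m n : nat) (M : 'M[R]_(m, n)) : 0 <= frob M.
Proof. exact: sqrtr_ge0. Qed.

Lemma frobZ (R : realType) (m n : nat) (c : R) (M : 'M[R]_(m, n)) : 0 <= c ->
  frob (c *: M) = c * frob M.
Proof.
move=> c0; apply/eqP.
rewrite -(@eqrXn2 _ 2)// ?mulr_ge0 ?frob_ge0// exprMn !sqr_frob mulr_sumr.
apply/eqP; apply: eq_bigr => i _; rewrite mulr_sumr; apply: eq_bigr => j _.
by rewrite mxE exprMn.
Qed.

Lemma sum_mul_le_frob (R : realType) (m n : nat) (M N : 'M[R]_(m, n)) :
  \sum_i \sum_j M i j * N i j <= frob M * frob N.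
Proof.
apply: le_trans (ler_norm _) _.
rewrite -(@ler_pXn2r _ 2) ?nnegrE ?mulr_ge0 ?frob_ge0// real_normK ?num_real//.
rewrite exprMn !sqr_frob !pair_big/=; exact: sum_mul_sqr_le.
Qed.

Lemma psd0 (R : realType) (n : nat) : psd (0 : 'M[R]_n).
Proof. by split=> [|x]; [exact: trmx0|rewrite mulmx0 mul0mx mxE]. Qed.

(** The Gram matrix X is a dual certificate: for PSD N, <N, X> is the sum of the forms of N at the
    columns of [A], hence nonnegative, so -<M, X> <= <N - M, X> <= |M - N| |X|. *)
Lemma distF_psd_ge (R : realType) (n d : nat) (A : 'M[R]_(n, d)) (M : 'M[R]_n) :
  0 < frob (A *m A^T) ->
  - (\sum_i \sum_j M i j * (A *m A^T) i j) / frob (A *m A^T) <= distF_psd M.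
Proof.
set X := A *m A^T => X0; apply: lb_le_inf.
  by exists (frob (M - 0)), 0 => //; exact: psd0.
move=> _ [N [_ N0] <-]; rewrite ler_pdivrMr//.
have NX : 0 <= \sum_i \sum_j N i j * X i j.
  have -> : \sum_i \sum_j N i j * X i j = \sum_l ((col l A)^T *m N *m col l A) 0 0.
    under [RHS]eq_bigr do rewrite quad_formE.
    rewrite [RHS]exchange_big; apply: eq_bigr => i _; rewrite [RHS]exchange_big.
    apply: eq_bigr => j _; rewrite mxE mulr_sumr; apply: eq_bigr => l _.
    by rewrite !mxE.
  by apply: sumr_ge0.
have := sum_mul_le_frob _ _ _ (N - M) X.
have -> : \sum_i \sum_j (N - M) i j * X i j
    = \sum_i \sum_j N i j * X i j - \sum_i \sum_j M i j * X i j.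
  rewrite -sumrB; apply: eq_bigr => i _; rewrite -sumrB; apply: eq_bigr => j _.
  by rewrite !mxE mulrBl.
have -> : frob (N - M) = frob (M - N).
  congr Num.sqrt; apply: eq_bigr => i _; apply: eq_bigr => j _.
  by rewrite !mxE -sqrrN opprB.
lra.
Qed.

Lemma distF_psd_le_frob (R : realType) (n : nat) (M : 'M[R]_n) : distF_psd M <= frob M.
Proof.
apply: ge_inf; first by exists 0 => _ [N _ <-]; exact: frob_ge0.
by exists 0; [exact: psd0|rewrite subr0].
Qed.

Lemma distF_psd_le_bardistF_psd (R : realType) (n : nat) (K : set 'M[R]_n) (M : 'M[R]_n) :
  K M -> frob M = 1 -> distF_psd M <= bardistF_psd K.
Proof.
move=> KM M1; apply: ub_le_sup; last by exists M.
by exists 1 => _ [N [_ N1] <-]; rewrite -N1; exact: distF_psd_le_frob.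
Qed.

Lemma kpsd_closureZ (R : realType) (n k : nat) (c : R) (M : 'M[R]_n) : 0 <= c ->
  kpsd_closure k M -> kpsd_closure k (c *: M).
Proof.
move=> c0 [symM kM]; split=> [|f fP].
  by rewrite /symmetric_mx linearZ/= symM.
have [symf f0] := kM f fP; rewrite /psd /symmetric_mx !linearZ/= symf; split=> // x.
by rewrite -scalemxAr -scalemxAl mxE mulr_ge0.
Qed.

(** The principal submatrix along [f] is c I - B B^T with B the selected rows of [A], and its form
    at x is c |x|^2 - |B^T x|^2. *)
Lemma kpsd_closure_scalar_sub (R : realType) (n k d : nat) (A : 'M[R]_(n, d)) (c : R) :
  (forall f : 'I_k -> 'I_n, injective f -> forall y : 'I_k -> R,
     \sum_j (\sum_i y i * A (f i) j) ^+ 2 <= c * \sum_i y i ^+ 2) ->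
  kpsd_closure k (c%:M - A *m A^T).
Proof.
move=> HA; split=> [|f fP].
  by rewrite /symmetric_mx linearB/= tr_scalar_mx trmx_mul trmxK.
have finj : injective f.
  move=> i j fij; apply/val_inj; case: (ltngtP i j) => // /fP; by rewrite fij ltnn.
have -> : mxsub f f (c%:M - A *m A^T) = c%:M - rowsub f A *m (rowsub f A)^T.
  apply/matrixP => i j; rewrite !mxE (inj_eq finj); congr (_ - _).
  by apply: eq_bigr => l _; rewrite !mxE.
split=> [|x]; first by rewrite /symmetric_mx linearB/= tr_scalar_mx trmx_mul trmxK.
set B := rowsub f A.
have qB : (x^T *m (B *m B^T) *m x) 0 0 = \sum_j (\sum_i x i 0 * A (f i) j) ^+ 2.
  rewrite mulmxA -mulmxA mxE; apply: eq_bigr => j _; rewrite expr2.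
  by congr (_ * _); rewrite mxE; apply: eq_bigr => i _; rewrite !mxE// mulrC.
have qc : (x^T *m c%:M *m x) 0 0 = c * \sum_i x i 0 ^+ 2.
  rewrite mul_mx_scalar -scalemxAl mxE mxE; congr (_ * _).
  by apply: eq_bigr => i _; rewrite mxE expr2.
by rewrite mulmxBr mulmxBl mxE [X in _ + X]mxE qB qc subr_ge0 (HA f finj (fun i => x i 0)).
Qed.

(** A A^T and A^T A have the same Frobenius norm, and A^T A has [d] diagonal entries equal to n. *)
Lemma frob_gram_ge (R : realType) (n d : nat) (A : 'M[R]_(n, d)) : (forall i j, A i j ^+ 2 = 1) ->
  n%:R ^+ 2 * d%:R <= frob (A *m A^T) ^+ 2.
Proof.
move=> A1; rewrite sqr_frob.
have -> : \sum_i \sum_j (A *m A^T) i j ^+ 2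
    = \sum_k \sum_l (\sum_i A i k * A i l) ^+ 2.
  transitivity (\sum_i \sum_j \sum_k \sum_l (A i k * A i l) * (A j k * A j l)).
    apply: eq_bigr => i _; apply: eq_bigr => j _; rewrite mxE expr2 mulr_suml.
    apply: eq_bigr => k _; rewrite mulr_sumr; apply: eq_bigr => l _.
    by rewrite !mxE; ring.
  under eq_bigr do rewrite exchange_big/=; rewrite exchange_big/=.
  apply: eq_bigr => k _.
  under eq_bigr do rewrite exchange_big/=; rewrite exchange_big/=.
  apply: eq_bigr => l _; rewrite expr2 mulr_suml; apply: eq_bigr => i _.
  by rewrite mulr_sumr.
rewrite -[d in leLHS]card_ord mulr_natr -sumr_const; apply: ler_sum => k _.
rewrite (bigD1 k)//= -[leLHS]addr0 lerD//; last first.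
  by apply: sumr_ge0 => l _; exact: sqr_ge0.
under eq_bigr do rewrite -expr2 A1.
by rewrite sumr_const card_ord.
Qed.

Lemma sum_scalar_sub_gram (R : realType) (n d : nat) (A : 'M[R]_(n, d)) (c : R) :
  (forall i j, A i j ^+ 2 = 1) ->
  \sum_i \sum_j (c%:M - A *m A^T) i j * (A *m A^T) i j
  = c * n%:R * d%:R - frob (A *m A^T) ^+ 2.
Proof.
move=> A1; rewrite sqr_frob; set X := A *m A^T.
have -> : c * n%:R * d%:R = \sum_i \sum_j c%:M i j * X i j.
  rewrite mulrAC -[n in LHS]card_ord mulr_natr -sumr_const; apply: eq_bigr => i _.
  rewrite (bigD1 i)//= big1 ?addr0 => [|j ji]; last by rewrite mxE eq_sym (negPf ji) mul0r.
  rewrite !mxE eqxx mulr1n; under eq_bigr do rewrite mxE -expr2 A1.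
  by rewrite sumr_const card_ord.
rewrite -sumrB; apply: eq_bigr => i _; rewrite -sumrB; apply: eq_bigr => j _.
by rewrite mxE mulrDl [X in _ + X * _]mxE mulNr expr2.
Qed.

(** * Normalisation and comparison of constants *)

Theorem theorem4 (R : realType) (r : R) (n k : nat) :
  r < 1 / 93 -> (0 < n)%N -> (0 < k)%N -> k%:R = r * n%:R -> (2 <= k)%N ->
  bardistF_psd (@kpsd_closure R n k) >
    Num.sqrt (r - 93 * r ^+ 2) / Num.sqrt (162 * r + 3).
Proof.
move=> r93 n0 k0 krn _.
have nR : 0 < n%:R :> R by rewrite ltr0n.
have kR : 0 < k%:R :> R by rewrite ltr0n.
have r0 : 0 < r by rewrite -(pmulr_lgt0 _ nR) -krn.
have kn : (93 * k < n)%N by rewrite -(ltr_nat R) natrM krn; nra.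
have [A [A1 HA]] := exists_sign_matrix R n k k0 kn.
set c : R := 5 / 8 * n%:R in HA.
have c0 : 0 <= c by rewrite mulr_ge0//; lra.
pose X := A *m A^T; pose M := c%:M - X.
have KM := kpsd_closure_scalar_sub R n k k A c HA.
set N : R := n%:R ^+ 2 * k%:R.
have N0 : 0 < N by rewrite mulr_gt0 ?exprn_gt0.
have NF : N <= frob X ^+ 2 := frob_gram_ge R n k A A1.
have X0 : 0 < frob X.
  rewrite lt0r frob_ge0 andbT; apply: contraTneq (lt_le_trans N0 NF) => ->.
  by rewrite expr0n ltxx.
have MX : \sum_i \sum_j M i j * X i j = 5 / 8 * N - frob X ^+ 2.
  by rewrite (sum_scalar_sub_gram R n k A c A1) -/X /c /N; ring.
(* As M = c I - X, |M|^2 = c tr M - <M, X>. From k = r n, N / r is n^3, so the first term is c^2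
   n. *)
have M2 : frob M ^+ 2 = 25 / 64 * N / r + (frob X ^+ 2 - 5 / 4 * N).
  transitivity (\sum_(i < n) c * M i i - \sum_i \sum_j M i j * X i j).
    rewrite sqr_frob -sumrB; apply: eq_bigr => i _.
    transitivity (\sum_j M i j * (c%:M i j - X i j)).
      by apply: eq_bigr => j _; rewrite expr2 {2}/M mxE [X in _ * (_ + X)]mxE.
    under eq_bigr do rewrite mulrBr.
    rewrite sumrB; congr (_ - _); rewrite (bigD1 i)//= big1 => [|j ji].
      by rewrite addr0 [c%:M i i]mxE eqxx mulrC.
    by rewrite [c%:M i j]mxE eq_sym (negPf ji) mulr0.
  have Mii i : M i i = c - k%:R.
    rewrite mxE [X in _ + X]mxE mxE eqxx mulr1n; congr (_ - _).
    rewrite mxE; under eq_bigr do rewrite mxE -expr2 A1.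
    by rewrite sumr_const card_ord.
  under eq_bigr do rewrite Mii.
  rewrite sumr_const card_ord -mulr_natr MX /c /N krn; field; exact: lt0r_neq0.
(* Thus 25/64 N / r alone exceeds 5/4 N, so M is nonzero and can be normalised. *)
have Nr : 93 * N < N / r by rewrite ltr_pdivlMr//; nra.
have M0 : 0 < frob M.
  rewrite lt0r frob_ge0 andbT; apply/eqP => M0.
  by move: M2; rewrite M0 expr0n/=; lra.
pose a := (frob M)^-1; have a0 : 0 <= a by rewrite invr_ge0 ltW.
have aM1 : frob (a *: M) = 1 by rewrite frobZ// mulVf// lt0r_neq0.
have KaM := kpsd_closureZ R n k a M a0 KM.
apply: lt_le_trans (distF_psd_le_bardistF_psd R n _ _ KaM aM1).
apply: lt_le_trans (distF_psd_ge R n k A (a *: M) X0).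
have -> : \sum_i \sum_j (a *: M) i j * X i j = a * (5 / 8 * N - frob X ^+ 2).
  rewrite -MX mulr_sumr; apply: eq_bigr => i _; rewrite mulr_sumr.
  by apply: eq_bigr => j _; rewrite mxE mulrA.
have p0 : 0 <= r - 93 * r ^+ 2 by nra.
have q0 : 0 < 162 * r + 3 by lra.
have sq0 : 0 < Num.sqrt (162 * r + 3) by rewrite sqrtr_gt0.
have Z0 : 0 <= frob X ^+ 2 - 5 / 8 * N by lra.
have -> : - (a * (5 / 8 * N - frob X ^+ 2)) / frob X
    = (frob X ^+ 2 - 5 / 8 * N) / (frob M * frob X).
  by rewrite /a; field; rewrite !lt0r_neq0.
rewrite ltr_pdivrMr// mulrAC ltr_pdivlMr ?mulr_gt0//.
rewrite -(@ltr_pXn2r _ 2) ?nnegrE ?mulr_ge0 ?sqrtr_ge0 ?frob_ge0//.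
rewrite !exprMn (sqr_sqrtr p0) (sqr_sqrtr (ltW q0)) M2.
move: (frob X ^+ 2) Z0 NF => F Z0 NF {MX M2}.
have -> : (r - 93 * r ^+ 2) * ((25 / 64 * N / r + (F - 5 / 4 * N)) * F)
   = (1 - 93 * r) * (25 / 64 * N + r * (F - 5 / 4 * N)) * F.
  by field; exact: lt0r_neq0.
have F0 : 0 < F by lra.
(* Since F >= N, F - 5N/8 is at least 3F/8, whose square gives 9/64 F^2. On the other side, 1 - 93 r
   <= 1 and dropping -5/4 r N leave 25/64 N + r F, which is below 9/64 F (162 r + 3) since 25 <
   27. *)
apply: (@lt_le_trans _ _ ((9 / 64 * F) * (162 * r + 3) * F)).
  rewrite ltr_pM2r//.
  have rF : 0 < r * F by rewrite mulr_gt0.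
  have rN : 0 < r * N by rewrite mulr_gt0.
  apply: (@le_lt_trans _ _ (1 * (25 / 64 * N + r * F))); last by lra.
  by apply: ler_pM; nra.
have -> : 9 / 64 * F * (162 * r + 3) * F = (3 / 8 * F) ^+ 2 * (162 * r + 3) by field.
by rewrite ler_pM2r// lerXn2r ?nnegrE//; lra.
Qed.
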